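(* Let $G$ be a finitely generated group, let $M$ be a closed manifold, and let $\varPhi$ be an expansive $C^0$-action of $G$ on $M$. Then the centralizer $\mathcal{C}^0(\varPhi)$ is a discrete subset of the space $\mathcal{A}^0(G,M)$ of $C^0$-actions of $G$ on $M$, endowed with the $C^0$-topology.
   Context: $d$ denotes the distance on $M$ induced by a Riemannian metric. A $C^0$-action (continuous action) of $G$ on $M$ is a continuous map $\varPhi:G\times M\to M$ ($G$ discrete) with $\varPhi(e,\cdot)=\mathrm{Id}_M$, $\varPhi(hg,x)=\varPhi(h,\varPhi(g,x))$; $gx=\varPhi(g,x)$ and $\varPhi_g=\varPhi(g,\cdot)$. Expansive (finitely generated $G$): there is $\delta>0$ such that for any two distinct points $x,y\in M$ there is $g\in G$ with $d(gx,gy)>\delta$. $\mathcal{C}^0(\varPhi)=\{\varPsi\in\mathcal{A}^0(G,M):\varPsi_g\circ\varPhi_h=\varPhi_h\circ\varPsi_g\text{ for all }g,h\in G\}$. The $C^0$-topology on $\mathcal{A}^0(G,M)$ is given by the distance $d_0(\varPhi,\varPsi)=\max_{g_i\in K}\sup_{x\in M}d(\varPhi_{g_i}(x),\varPsi_{g_i}(x))$, where $K$ is a finite generating set of $G$. *)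

(* Defs.v *)
From HB Require Import structures.
From mathcomp Require Import all_boot all_order all_algebra.
From mathcomp Require Import all_classical all_reals all_analysis.
Set Implicit Arguments.
Unset Strict Implicit.
Unset Printing Implicit Defensive.
Import Order.TTheory GRing.Theory Num.Theory.
Import numFieldNormedType.Exports.
Local Open Scope classical_set_scope.
Local Open Scope ring_scope.

(* C^k on an open set [U]; only the germs of [f] at the points of [U] matter. *)
Fixpoint Ck_on (R : realType) (V W : normedModType R) (k : nat) (U : set V)
    (f : V -> W) : Prop :=
  match k with
  | 0 => forall x, U x -> {for x, continuous f}
  | j.+1 => (forall x, U x -> differentiable f x) /\
            (forall v : V, Ck_on j U (fun x => 'D_v f x))
  end.

Definition smooth_on (R : realType) (V W : normedModType R) (U : set V)
  (f : V -> W) : Prop := forall k, Ck_on k U f.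

(* A homeomorphism from the open set [cdom] of [M] onto the open set [cimg] of
   R^n. Outside of [cdom] and [cimg], [cmap] and [cinv] take junk values. *)
Record chart (R : realType) (M : topologicalType) (n : nat) := Chart {
  cdom : set M;
  cmap : M -> 'rV[R]_n;
  cinv : 'rV[R]_n -> M;
  cdom_open : open cdom;
  cimg_open : open (cmap @` cdom);
  cmapK : forall x, cdom x -> cinv (cmap x) = x;
  cmap_continuous : forall x, cdom x -> {for x, continuous cmap};
  cinv_continuous : forall u, (cmap @` cdom) u -> {for u, continuous cinv}
}.

Definition cimg (R : realType) (M : topologicalType) (n : nat)
  (phi : chart R M n) : set 'rV[R]_n := cmap phi @` cdom phi.

Definition transition (R : realType) (M : topologicalType) (n : nat)
  (phi psi : chart R M n) : 'rV[R]_n -> 'rV[R]_n := cmap psi \o cinv phi.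

(* A closed manifold: a compact smooth n-manifold without boundary, not
   necessarily connected. [chart_at] is a choice of a chart of the atlas around
   each point; in particular the atlas covers the manifold. *)
Record closedManifold (R : realType) (n : nat) := ClosedManifold {
  carrier :> topologicalType;
  carrier_hausdorff : hausdorff_space carrier;
  carrier_second_countable : @second_countable carrier;
  carrier_compact : compact [set: carrier];
  atlas : set (chart R carrier n);
  chart_at : carrier -> chart R carrier n;
  chart_at_atlas : forall x, atlas (chart_at x);
  chart_at_dom : forall x, cdom (chart_at x) x;
  atlas_smooth : forall phi psi, atlas phi -> atlas psi ->
    smooth_on (cmap phi @` (cdom phi `&` cdom psi)) (transition phi psi)
}.

(* The bilinear form with Gram matrix [B], on row vectors. *)
Definition bilin (R : realType) (n : nat) (B : 'M[R]_n) (v w : 'rV[R]_n) : R :=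
  (v *m B *m w^T) ord0 ord0.

(* A smooth Riemannian metric, given by its Gram matrices in the charts; the
   last axiom is the tensor transformation law under changes of charts. *)
Record riemannianMetric (R : realType) (n : nat) (M : closedManifold R n) :=
  RiemannianMetric {
  gram : chart R M n -> 'rV[R]_n -> 'M[R]_n;
  gram_smooth : forall phi, atlas phi -> smooth_on (cimg phi) (gram phi);
  gram_sym : forall phi u, atlas phi -> cimg phi u ->
    (gram phi u)^T = gram phi u;
  gram_posdef : forall phi u (v : 'rV[R]_n), atlas phi -> cimg phi u ->
    v != 0 -> 0 < bilin (gram phi u) v v;
  gram_transition : forall phi psi x (v w : 'rV[R]_n),
    atlas phi -> atlas psi -> cdom phi x -> cdom psi x ->
    bilin (gram phi (cmap phi x)) v w =
    bilin (gram psi (cmap psi x))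
      ('d (transition phi psi) (cmap phi x) v)
      ('d (transition phi psi) (cmap phi x) w)
}.

(* [c] restricts to a C^1 curve on [0, 1]. One-sided derivatives at the
   endpoints are avoided by asking that [c] be differentiable around [0, 1];
   every C^1 curve on [0, 1] has such an extension. *)
Definition C1_curve (R : realType) (n : nat) (M : closedManifold R n)
    (c : R -> M) : Prop :=
  forall t : R, 0 <= t <= 1 ->
    (\forall s \near t, {for s, continuous c}) /\
    (forall phi, atlas phi -> cdom phi (c t) ->
       (\forall s \near t, derivable (cmap phi \o c) s 1) /\
       {for t, continuous (derive1 (cmap phi \o c))}).

Definition speed (R : realType) (n : nat) (M : closedManifold R n)
    (g : riemannianMetric M) (c : R -> M) (t : R) : R :=
  let phi := chart_at (c t) in
  let v := derive1 (cmap phi \o c) t in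
  Num.sqrt (bilin (gram g phi (cmap phi (c t))) v v).

Definition curve_length (R : realType) (n : nat) (M : closedManifold R n)
    (g : riemannianMetric M) (c : R -> M) : \bar R :=
  (\int[@lebesgue_measure R]_(t in `[0%R, 1%R]) (speed g c t)%:E)%E.

(* Piecewise C^1 curves from [x] to [y], encoded as the list of their C^1
   pieces, each one parametrized by [0, 1]. *)
Fixpoint joins (R : realType) (n : nat) (M : closedManifold R n)
    (x : M) (s : seq (R -> M)) (y : M) : Prop :=
  match s with
  | [::] => x = y
  | c :: s' => [/\ C1_curve c, c 0 = x & joins (c 1) s' y]
  end.

(* The distance induced by the metric; it is +oo between points of different
   connected components (infimum of the empty set). *)
Definition riem_dist (R : realType) (n : nat) (M : closedManifold R n)
    (g : riemannianMetric M) (x y : M) : \bar R :=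
  ereal_inf [set (\sum_(c <- s) curve_length g c)%E | s in
               [set s : seq (R -> M) | joins x s y]].

(* The subgroup generated by [K] is the whole group. *)
Definition generates (G : groupType) (K : seq G) : Prop :=
  forall H : set G,
    H 1%g -> (forall a b, H a -> H b -> H (a * b)%g) ->
    (forall a, H a -> H (a^-1)%g) -> (forall k, k \in K -> H k) ->
    forall a, H a.

Record C0action (G : groupType) (M : topologicalType) := C0Action {
  act :> G -> M -> M;
  act_continuous : continuous (fun p : discrete_topology G * M => act p.1 p.2);
  act1 : act 1%g = id;
  actM : forall h a x, act (h * a)%g x = act h (act a x)
}.

Definition expansive (R : realType) (n : nat) (M : closedManifold R n)
    (g : riemannianMetric M) (G : groupType) (Phi : C0action G M) : Prop :=
  exists2 delta : R, 0 < delta &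
    forall x y : M, x <> y ->
      exists a : G, (delta%:E < riem_dist g (Phi a x) (Phi a y))%E.

Definition centralizer (G : groupType) (M : topologicalType)
    (Phi : C0action G M) : set (C0action G M) :=
  [set Psi : C0action G M | forall a h : G, Psi a \o Phi h = Phi h \o Psi a].

(* All terms of the maximum are nonnegative unless [M] is empty, hence the
   neutral element 0. *)
Definition C0dist (R : realType) (n : nat) (M : closedManifold R n)
    (g : riemannianMetric M) (G : groupType) (K : seq G)
    (Phi Psi : C0action G M) : \bar R :=
  (\big[maxe/0]_(k <- K)
     ereal_sup [set riem_dist g (Phi k x) (Psi k x) | x in [set: M]])%E.

(* The space of C^0-actions with the topology of the distance [C0dist g K]. *)
Definition C0actions (R : realType) (n : nat) (M : closedManifold R n)
  (g : riemannianMetric M) (G : groupType) (K : seq G) : Type := C0action G M.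

Section C0topology.
Context (R : realType) (n : nat) (M : closedManifold R n).
Context (g : riemannianMetric M) (G : groupType) (K : seq G).

HB.instance Definition _ := gen_eqMixin (C0actions g K).
HB.instance Definition _ := gen_choiceMixin (C0actions g K).

Definition C0open : set_system (C0actions g K) :=
  [set U | forall Phi, U Phi -> exists2 e : R, 0 < e &
     forall Psi : C0actions g K, (C0dist g K Phi Psi < e%:E)%E -> U Psi].

Let C0openT : C0open setT.
Proof. by move=> Phi _; exists 1. Qed.

Let C0openI : setI_closed C0open.
Proof.
move=> A B oA oB Phi [/oA[e e0 eA] /oB[f f0 fB]].
exists (Num.min e f); first by rewrite lt_min e0 f0.
move=> Psi; rewrite EFin_min lt_min => /andP[he hf].
by split; [exact: eA|exact: fB].
Qed.

Let C0open_bigcup (I : Type) (f : I -> set (C0actions g K)) :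
  (forall i, C0open (f i)) -> C0open (\bigcup_i f i).
Proof.
move=> of_ Phi [i _ /of_[e e0 eU]].
by exists e => // Psi /eU ?; exists i.
Qed.

HB.instance Definition _ := isOpenTopological.Build (C0actions g K)
  C0openT C0openI C0open_bigcup.

End C0topology.

Definition discrete_subset (T : topologicalType) (A : set T) : Prop :=
  A `<=` isolated A.

(* Main.v *)
Require Import Defs.
From mathcomp Require Import all_boot all_order all_algebra.
From mathcomp Require Import all_classical all_reals all_analysis.

(** Let [Psi] and [Psi'] be actions commuting with [Phi], whose distance is
    less than an expansivity constant [delta] of [Phi], and let [k] be one of
    the generators. For every point [x] and every group element [a],
      [d (a (Psi_k x), a (Psi'_k x)) = d (Psi_k (a x), Psi'_k (a x)) < delta],
    where [a] acts through [Phi]: commutation transports the whole [Phi]-orbit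
    of the pair [(Psi_k x, Psi'_k x)] into the uniform estimate given by the
    [C^0]-distance. Expansivity forces [Psi_k x = Psi'_k x]
    ([centralizer_close_eq]), and two actions agreeing on generators are equal
    ([C0action_eq_on_generators]). So the ball of radius [delta] around [Psi]
    meets the centralizer only in [Psi].

    The topology is given by its open sets, so it remains to see that balls are
    open ([C0ball_open]). This is the triangle inequality, which comes from the
    concatenation of piecewise [C^1] curves; the distances are extended reals,
    as [M] may be disconnected. *)

Set Implicit Arguments.
Unset Strict Implicit.
Unset Printing Implicit Defensive.
Import Order.TTheory GRing.Theory Num.Theory.
Local Open Scope classical_set_scope.
Local Open Scope ereal_scope.

Section RiemannianDistance.
Context (R : realType) (n : nat) (M : closedManifold R n).
Context (g : riemannianMetric M).
Implicit Types (x y z : M) (s : seq (R -> M)).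

Lemma joins_cat x y z s s' : joins x s y -> joins y s' z -> joins x (s ++ s') z.
Proof.
elim: s x => [x -> //|c s IHs x [C1c c0 sy] s'z].
by split => //; exact: IHs.
Qed.

Lemma curve_length_ge0 (c : R -> M) : 0 <= curve_length g c.
Proof. by apply: integral_ge0 => t _; rewrite lee_fin sqrtr_ge0. Qed.

Lemma riem_dist_ge0 x y : 0 <= riem_dist g x y.
Proof.
apply: le_ereal_inf_tmp => _ [s _ <-].
by apply: sume_ge0 => c _; exact: curve_length_ge0.
Qed.

Lemma riem_dist_refl_le0 x : riem_dist g x x <= 0.
Proof. by apply: ereal_inf_lbound; exists [::] => //; rewrite big_nil. Qed.

(** Concatenating almost shortest curves. These exist only when both distances
    on the right are finite; an infinite one, that is a pair of points in
    different components, makes the right-hand side infinite because the other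
    term is nonnegative. *)
Lemma riem_dist_triangle x y z :
  riem_dist g x z <= riem_dist g x y + riem_dist g y z.
Proof.
have [->|dxy_fin] := (gee0P _).1 (riem_dist_ge0 x y).
  by rewrite addye ?leey// gt_eqF// (lt_le_trans _ (riem_dist_ge0 y z)).
have [->|dyz_fin] := (gee0P _).1 (riem_dist_ge0 y z).
  by rewrite addey ?leey// gt_eqF// (lt_le_trans _ (riem_dist_ge0 x y)).
have {}dxy_fin : riem_dist g x y \is a fin_num by case: dxy_fin => r _ ->.
have {}dyz_fin : riem_dist g y z \is a fin_num by case: dyz_fin => r _ ->.
apply/lee_addgt0Pr => e e0; have e20 : (0 < e / 2)%R by rewrite divr_gt0.
have [_ [s sxy <-] lt_s] := lb_ereal_inf_adherent e20 dxy_fin.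
have [_ [s' syz <-] lt_s'] := lb_ereal_inf_adherent e20 dyz_fin.
have le_cat : riem_dist g x z <= \sum_(c <- s ++ s') curve_length g c.
  by apply: ereal_inf_lbound; exists (s ++ s') => //; exact: joins_cat syz.
apply: (le_trans le_cat); rewrite big_cat/= [e]splitr EFinD addeACA.
by apply: leeD; exact: ltW.
Qed.

End RiemannianDistance.

Section C0Distance.
Context (R : realType) (n : nat) (M : closedManifold R n).
Context (g : riemannianMetric M) (G : groupType) (K : seq G).
Implicit Types (Phi Psi : C0action G M).

Lemma C0dist_ge0 Phi Psi : 0 <= C0dist g K Phi Psi.
Proof. exact: bigmax_ge_id. Qed.

Lemma riem_dist_le_C0dist Phi Psi k x : k \in K ->
  riem_dist g (Phi k x) (Psi k x) <= C0dist g K Phi Psi.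
Proof.
move=> kK; apply: Order.TotalTheory.bigmax_sup_seq kK _ _ => //.
by apply: ereal_sup_ubound; exists x.
Qed.

Lemma C0dist_le Phi Psi (r : \bar R) : 0 <= r ->
  (forall k x, k \in K -> riem_dist g (Phi k x) (Psi k x) <= r) ->
  C0dist g K Phi Psi <= r.
Proof.
move=> r0 le_r; rewrite /C0dist big_seq; apply: bigmax_le => // k kK.
by apply: ge_ereal_sup => _ [x _ <-]; exact: le_r.
Qed.

Lemma C0dist_refl Phi : C0dist g K Phi Phi = 0.
Proof.
apply/eqP; rewrite eq_le C0dist_ge0 andbT.
by apply: C0dist_le => // k x _; exact: riem_dist_refl_le0.
Qed.

Lemma C0dist_triangle Phi Psi Theta :
  C0dist g K Phi Theta <= C0dist g K Phi Psi + C0dist g K Psi Theta.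
Proof.
apply: C0dist_le => [|k x kK]; first by rewrite adde_ge0 ?C0dist_ge0.
by apply: le_trans (riem_dist_triangle _ _ (Psi k x) _) _;
  apply: leeD; exact: riem_dist_le_C0dist.
Qed.

Lemma C0ball_open Psi (e : R) :
  open [set Theta : C0actions g K | C0dist g K Psi Theta < e%:E].
Proof.
move=> /= Theta ltTheta.
have d_fin : C0dist g K Psi Theta \is a fin_num.
  by rewrite ge0_fin_numE ?C0dist_ge0// (lt_trans ltTheta) ?ltry.
exists (e - fine (C0dist g K Psi Theta))%R.
  by rewrite subr_gt0 -lte_fin fineK.
move=> Theta'; rewrite EFinB fineK// lteBrDl//.
exact/le_lt_trans/C0dist_triangle.
Qed.

End C0Distance.

Section C0Action.
Context (G : groupType) (M : topologicalType).
Implicit Types (Phi Psi : C0action G M).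

Lemma C0action_eq Phi Psi : (forall a, Phi a = Psi a) -> Phi = Psi.
Proof.
case: Phi Psi => [f fC f1 fM] [h hC h1 hM] /= /funext fh.
rewrite -{}fh in hC h1 hM *; congr C0Action; exact: Prop_irrelevance.
Qed.

Lemma actVK Phi a x : Phi a (Phi (a^-1)%g x) = x.
Proof. by rewrite -actM mulgV act1. Qed.

Lemma actKV Phi a x : Phi (a^-1)%g (Phi a x) = x.
Proof. by rewrite -actM mulVg act1. Qed.

(** The elements acting equally form a subgroup: for inverses, this is because
    [Phi (a^-1)] and [Psi (a^-1)] invert the same bijection. *)
Lemma C0action_eq_on_generators (K : seq G) Phi Psi : generates K ->
  (forall k, k \in K -> Phi k = Psi k) -> Phi = Psi.
Proof.
move=> genK eqK; apply: C0action_eq.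
apply: (genK [set a | Phi a = Psi a]) => //= [|a b eqa eqb|a eqa].
- by rewrite !act1.
- by apply/funext => x; rewrite !actM eqa eqb.
- by apply/funext => x; rewrite -{1}[x](actVK Psi a) -eqa actKV.
Qed.

End C0Action.

(** The uniform estimate is applied at the point [Phi a x], not at [x]: this is
    what bounds the distance along the whole orbit without any modulus of
    continuity of [Phi a]. *)
Lemma centralizer_close_eq (R : realType) (n : nat) (M : closedManifold R n)
    (g : riemannianMetric M) (G : groupType) (K : seq G)
    (Phi Psi Psi' : C0action G M) (delta : R) :
  generates K ->
  (forall x y : M, x <> y ->
     exists a : G, delta%:E < riem_dist g (Phi a x) (Phi a y)) ->
  centralizer Phi Psi -> centralizer Phi Psi' ->
  C0dist g K Psi Psi' < delta%:E -> Psi = Psi'.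
Proof.
move=> genK expPhi cPsi cPsi' near_Psi.
apply: (C0action_eq_on_generators genK) => k kK; apply/funext => x.
apply: contrapT => /expPhi[a]; apply/negP; rewrite -leNgt.
have <- : Psi k (Phi a x) = Phi a (Psi k x).
  exact: (congr1 (@^~ x) (cPsi k a)).
have <- : Psi' k (Phi a x) = Phi a (Psi' k x).
  exact: (congr1 (@^~ x) (cPsi' k a)).
exact: le_trans (riem_dist_le_C0dist g Psi Psi' (Phi a x) kK) (ltW near_Psi).
Qed.

Theorem theorem7 (R : realType) (n : nat) (M : closedManifold R n)
  (g : riemannianMetric M) (G : groupType) (K : seq G) (hK : generates K)
  (Phi : C0action G M) (hPhi : expansive g Phi) :
  discrete_subset (centralizer Phi : set (C0actions g K)).
Proof.
case: hPhi => delta delta0 expPhi Psi cPsi; rewrite /isolated /=.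
split; first exact: mem_set.
exists [set Theta : C0actions g K | C0dist g K Psi Theta < delta%:E].
  apply: open_nbhs_nbhs; split; first exact: C0ball_open.
  by rewrite /= C0dist_refl lte_fin.
apply/seteqP; split => [Psi' [near_Psi cPsi']|_ ->].
  by rewrite (centralizer_close_eq hK expPhi cPsi cPsi' near_Psi).
by split; rewrite //= C0dist_refl lte_fin.
Qed.
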